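(* Let $\gamma\in[0,2]$ and let $q:\mathbb{R}^d\to\mathbb{R}^d$ be continuous with $$\limsup_{|x|\to\infty}\,(q(x)\cdot x)_+<1.$$ Then every function $u$ with $\inf_{\mathbb{R}^d}u>-\infty$ that satisfies, in the viscosity sense, $$\Delta_\infty^\gamma u+q(x)\cdot\nabla u\,|\nabla u|^{2-\gamma}\le0\quad\text{in }\mathbb{R}^d$$ is necessarily a constant.
   Context: $t_+=\max\{t,0\}$. For a $C^2$ function $\varphi$, $\Delta_\infty^\gamma\varphi=|\nabla\varphi|^{-\gamma}\sum_{i,j=1}^d\partial_{x_i}\varphi\,\partial_{x_ix_j}\varphi\,\partial_{x_j}\varphi$. Viscosity sense: a lower-semicontinuous $u$ satisfies $\Delta_\infty^\gamma u+G(x,u,\nabla u)\le0$ in an open set $U\subset\mathbb{R}^d$ (with $G$ continuous) if, whenever $x_0\in U$ and $\varphi$ is $C^2$ near $x_0$ with $u(x_0)=\varphi(x_0)$ and $u>\varphi$ in a punctured ball around $x_0$, one has $\Delta_\infty^\gamma\varphi(x_0)+G(x_0,u(x_0),\nabla\varphi(x_0))\le0$; if $\nabla\varphi(x_0)=0$, the term $\Delta_\infty^\gamma\varphi(x_0)$ is read as $0$ when $\gamma<2$ and as $m(D^2\varphi(x_0))=\min_{|\xi|=1}\langle\xi,D^2\varphi(x_0)\xi\rangle$ when $\gamma=2$. *)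

(* Defs.v *)
From HB Require Import structures.
From mathcomp Require Import all_boot all_order all_algebra.
From mathcomp Require Import all_classical all_reals all_analysis.
Set Implicit Arguments.
Unset Strict Implicit.
Unset Printing Implicit Defensive.
Import Order.TTheory GRing.Theory Num.Theory.
Import numFieldNormedType.Exports.
Local Open Scope classical_set_scope.
Local Open Scope ring_scope.

(** R^d is 'rV[R]_d. The library norm of 'rV[R]_d is the sup norm, so the
    Euclidean norm is introduced here; both induce the same topology. *)

Definition dot (R : realType) (d : nat) (x y : 'rV[R]_d) : R :=
  \sum_(i < d) x ord0 i * y ord0 i.

Definition enorm (R : realType) (d : nat) (x : 'rV[R]_d) : R :=
  Num.sqrt (dot x x).

Definition at_infinity (R : realType) (d : nat) : set_system 'rV[R]_d :=
  filter_from [set: R] (fun r => [set x | r < enorm x]).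
Arguments at_infinity : clear implicits.

Definition ebasis (R : realType) (d : nat) (i : 'I_d) : 'rV[R]_d :=
  delta_mx ord0 i.

Definition partial (R : realType) (d : nat) (i : 'I_d) (phi : 'rV[R]_d -> R)
    : 'rV[R]_d -> R :=
  fun x => 'D_(ebasis R i) phi x.

Definition grad (R : realType) (d : nat) (phi : 'rV[R]_d -> R) (x : 'rV[R]_d)
    : 'rV[R]_d :=
  \row_(i < d) partial i phi x.

Definition hessian (R : realType) (d : nat) (phi : 'rV[R]_d -> R)
    (x : 'rV[R]_d) : 'M[R]_d :=
  \matrix_(i < d, j < d) partial j (partial i phi) x.

(** The values of [phi] away from [x0] are irrelevant, so that a total function
    represents one that is only defined near [x0]. *)
Definition C2_near (R : realType) (d : nat) (phi : 'rV[R]_d -> R)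
    (x0 : 'rV[R]_d) : Prop :=
  \forall x \near x0,
    [/\ {for x, continuous phi},
        forall i, derivable phi x (ebasis R i)
                  /\ {for x, continuous (partial i phi)}
      & forall i j, derivable (partial i phi) x (ebasis R j)
                  /\ {for x, continuous (partial j (partial i phi))}].

(** The infimum is attained for [0 < d], the unit sphere being compact. *)
Definition min_quad (R : realType) (d : nat) (A : 'M[R]_d) : R :=
  inf [set dot xi (xi *m A^T) | xi in [set xi : 'rV[R]_d | enorm xi = 1]].

(** Only meant for [gamma] in [0, 2]; the case of a vanishing gradient is the
    convention of the viscosity sense for supersolutions. *)
Definition inf_laplacian (R : realType) (d : nat) (gamma : R)
    (phi : 'rV[R]_d -> R) (x : 'rV[R]_d) : R :=
  let p := grad phi x in
  let H := hessian phi x in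
  if p == 0 then (if gamma < 2 then 0 else min_quad H)
  else enorm p `^ (- gamma)
       * \sum_(i < d) \sum_(j < d) p ord0 i * H i j * p ord0 j.

Definition viscosity_supersolution (R : realType) (d : nat) (gamma : R)
    (G : 'rV[R]_d -> R -> 'rV[R]_d -> R) (U : set 'rV[R]_d)
    (u : 'rV[R]_d -> R) : Prop :=
  forall (x0 : 'rV[R]_d) (phi : 'rV[R]_d -> R),
    U x0 -> C2_near phi x0 -> u x0 = phi x0 ->
    (\forall x \near x0^', phi x < u x) ->
    inf_laplacian gamma phi x0 + G x0 (u x0) (grad phi x0) <= 0.

(* Main.v *)
(** The operator |Du|^gamma Delta_infty^gamma u is <D^2 u Du, Du>, so gamma only
    matters where the gradient of the test function vanishes, and radial test
    functions h(|x - y|^2) with h' < 0 avoid that case away from y.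
    With t = |x - y|^2, such a function is a strict subsolution at x when
    2 t h'' > - h' (1 + q(x).(x - y)).

    At infinity, where q(x).x <= theta < 1, this holds for h = - e ln (1 + t).
    This barrier tends to -oo, so u - h attains its minimum, necessarily in a
    fixed ball; letting e tend to 0, u attains its infimum, at z say.

    If u y > u z, then u > u z + c near y, and the barrier c exp (- a |x - y|^2)
    with a large is a strict subsolution for r <= |x - y|^2 <= |z - y|^2. The
    difference attains its minimum in that annulus, because beyond z the barrier
    is smaller than at z: a contradiction. *)
Require Import Defs.
From HB Require Import structures.
From mathcomp Require Import all_boot all_order all_algebra.
From mathcomp Require Import all_classical all_reals all_analysis.
From mathcomp Require Import finmap ring lra.
Set Implicit Arguments.
Unset Strict Implicit.
Unset Printing Implicit Defensive.
Import Order.TTheory GRing.Theory Num.Theory.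
Import numFieldNormedType.Exports.
Local Open Scope classical_set_scope.
Local Open Scope ring_scope.

(** * Directional derivatives, and continuity of the squared distance *)

(** Both difference quotients are the same function of the increment. One-variable calculus, the
    chain rule above all, thus transfers to directional derivatives without total differentiability
    of [f]. *)
Lemma is_derive_lineP (R : realType) (d : nat) (f : 'rV[R]_d -> R)
    (x v : 'rV[R]_d) (df : R) :
  is_derive x v f df <-> is_derive (0 : R) 1 (fun s => f (s *: v + x)) df.
Proof.
have E : (fun h : R => h^-1 *: ((f \o shift x) (h *: v) - f x)) =
  (fun h : R => h^-1 *: (((fun s => f (s *: v + x)) \o shift 0) (h *: 1)
                         - f (0 *: v + x))).
  by apply/funext => h /=; rewrite scale0r add0r addr0 [h *: 1]mulr1.
split=> -[D1 D2]; split.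
- by rewrite /derivable -E.
- by rewrite /derive -E.
- by rewrite /derivable E.
- by rewrite /derive E.
Qed.

Lemma is_derive_comp1 (R : realType) (d : nat) (f : R -> R) (g : 'rV[R]_d -> R)
    (x v : 'rV[R]_d) (a b : R) :
  is_derive (g x) 1 f a -> is_derive x v g b -> is_derive x v (f \o g) (a * b).
Proof.
move=> fa /is_derive_lineP gb; apply/is_derive_lineP.
apply: (@is_derive1_comp R f (fun s => g (s *: v + x)) 0 a b) => //.
by rewrite scale0r add0r.
Qed.

Lemma is_derive_coord (R : realType) (d : nat) (i : 'I_d) (x v : 'rV[R]_d) :
  is_derive x v (fun z : 'rV[R]_d => z ord0 i) (v ord0 i).
Proof.
apply/is_derive_lineP.
rewrite (_ : (fun _ => _) = (fun s : R => v ord0 i * s + x ord0 i)).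
  by apply: is_derive_eq; rewrite !(addr0, mulr0, scaler0,add0r) [_ *: _]mulr1.
by apply/funext => s; rewrite !mxE mulrC.
Qed.

Lemma is_derive_sqdist (R : realType) (d : nat) (y x v : 'rV[R]_d) :
  is_derive x v (fun z => dot (z - y) (z - y)) (2 * dot (x - y) v).
Proof.
rewrite (_ : (fun _ => _) =
   \sum_(i < d) (fun z : 'rV[R]_d =>
     (z ord0 i - y ord0 i) * (z ord0 i - y ord0 i))).
  have H i : is_derive x v
      (fun z : 'rV[R]_d => (z ord0 i - y ord0 i) * (z ord0 i - y ord0 i))
      (2 * ((x - y) ord0 i * v ord0 i)).
    have := is_derive_coord i x v => D.
    by apply: is_derive_eq; rewrite !mxE oppr0 addr0 /GRing.scale /=; ring.
  by apply: is_derive_eq; rewrite -mulr_sumr.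
by apply/funext => z; rewrite fct_sumE; apply: eq_bigr => i _; rewrite !mxE.
Qed.

Lemma continuous_subr (R : realType) (d : nat) (y : 'rV[R]_d) :
  continuous (fun z : 'rV[R]_d => z - y).
Proof.
by move=> x; apply: (@cvgB _ _ _ (nbhs x)); [exact: cvg_id | exact: cvg_cst].
Qed.

Lemma continuous_coordB (R : realType) (d : nat) (y : 'rV[R]_d) (i : 'I_d) :
  continuous (fun z : 'rV[R]_d => (z - y) ord0 i).
Proof.
move=> x; apply: (@continuous_comp 'rV[R]_d 'rV[R]_d R
  (fun z => z - y) (fun z : 'rV[R]_d => z ord0 i) x).
  exact: continuous_subr.
exact: coord_continuous.
Qed.

Lemma continuous_dot (R : realType) (d : nat) (T : topologicalType)
    (f g : T -> 'rV[R]_d) (x : T) :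
  {for x, continuous f} -> {for x, continuous g} ->
  {for x, continuous (fun z => dot (f z) (g z))}.
Proof.
move=> fx gx.
apply: (@cvg_big R _ +%R 0 xpredT
   (@pseudometric_normed_Zmodule.add_continuous R R) T (nbhs x) (index_enum 'I_d)
   (fun i z => f z ord0 i * g z ord0 i) (fun i => f x ord0 i * g x ord0 i)) => i _.
have C (k : T -> 'rV[R]_d) : {for x, continuous k} ->
    {for x, continuous (fun z => k z ord0 i)}.
  move=> kx.
  apply: (@continuous_comp T 'rV[R]_d R k (fun z : 'rV[R]_d => z ord0 i) x kx).
  exact: coord_continuous.
exact: cvgM (C _ fx) (C _ gx).
Qed.

Lemma continuous_sqdist (R : realType) (d : nat) (y : 'rV[R]_d) :
  continuous (fun z : 'rV[R]_d => dot (z - y) (z - y)).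
Proof.
move=> x; apply: (@continuous_dot R d 'rV[R]_d (fun z => z - y) (fun z => z - y));
  exact: continuous_subr.
Qed.

Lemma dot_ge0 (R : realType) (d : nat) (x : 'rV[R]_d) : 0 <= dot x x.
Proof. by apply: sumr_ge0 => i _; rewrite -expr2 sqr_ge0. Qed.

Lemma dot_eq0 (R : realType) (d : nat) (x : 'rV[R]_d) : (dot x x == 0) = (x == 0).
Proof.
apply/eqP/eqP => [x0|->]; last by rewrite /dot big1 // => i _; rewrite mxE mul0r.
apply/rowP => i; rewrite mxE; apply/eqP; rewrite -sqrf_eq0; apply/eqP.
by apply: (psumr_eq0P _ x0) => // j _; rewrite -expr2 sqr_ge0.
Qed.

Lemma dot_gt0 (R : realType) (d : nat) (x : 'rV[R]_d) : (0 < dot x x) = (x != 0).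
Proof. by rewrite lt_def dot_eq0 dot_ge0 andbT. Qed.

Lemma dotZr (R : realType) (d : nat) (a : R) (x y : 'rV[R]_d) :
  dot x (a *: y) = a * dot x y.
Proof. by rewrite /dot mulr_sumr; apply: eq_bigr => i _; rewrite mxE mulrCA. Qed.

Lemma dotC (R : realType) (d : nat) (x y : 'rV[R]_d) : dot x y = dot y x.
Proof. by apply: eq_bigr => i _; rewrite mulrC. Qed.

(** * Radial test functions and the inequality at a touching point *)

Section RadialTestFunction.
Variables (R : realType) (d : nat) (h h1 h2 : R -> R).
Hypothesis (dh : forall t : R, 0 <= t -> is_derive t 1 h (h1 t)).
Hypothesis (dh1 : forall t : R, 0 <= t -> is_derive t 1 h1 (h2 t)).
Hypothesis (ch2 : forall t : R, 0 <= t -> {for t, continuous h2}).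

(** The quadratic term turns contact at [x0] into the strict contact that the viscosity definition
    asks for. As [h] is evaluated only at squared distances, its regularity is assumed on
    nonnegative reals alone, which admits the logarithm. *)
Definition bump (y x0 : 'rV[R]_d) (eta : R) : 'rV[R]_d -> R :=
  fun x => h (dot (x - y) (x - y)) - eta * dot (x - x0) (x - x0).

Lemma dot_ebasis (x : 'rV[R]_d) i : dot x (ebasis R i) = x ord0 i.
Proof.
rewrite /dot (bigD1 i) //= big1 ?addr0 /ebasis ?mxE ?eqxx ?mulr1 // => j ji.
by rewrite mxE eqxx /= (negbTE ji) mulr0.
Qed.

Lemma is_derive_bump y x0 eta i x : is_derive x (ebasis R i) (bump y x0 eta)
  (2 * h1 (dot (x - y) (x - y)) * (x - y) ord0 i - 2 * eta * (x - x0) ord0 i).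
Proof.
rewrite (_ : bump _ _ _ = (h \o (fun x => dot (x - y) (x - y))) -
  cst eta * (fun x => dot (x - x0) (x - x0))) //.
have D1 := is_derive_comp1 (g := fun x : 'rV[R]_d => dot (x - y) (x - y))
   (dh (dot_ge0 (x - y)))
   (is_derive_sqdist y x (ebasis R i)).
have D2 := is_derive_sqdist x0 x (ebasis R i).
apply: is_derive_eq; rewrite !dot_ebasis scaler0 addr0 /GRing.scale /=; ring.
Qed.

Lemma partial_bump y x0 eta i : partial i (bump y x0 eta) =
  fun x => 2 * h1 (dot (x - y) (x - y)) * (x - y) ord0 i - 2 * eta * (x - x0) ord0 i.
Proof.
by apply/funext => x; case: (is_derive_bump y x0 eta i x).
Qed.

Lemma is_derive_partial_bump y x0 eta i j x :
  is_derive x (ebasis R j) (partial i (bump y x0 eta))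
  (4 * h2 (dot (x - y) (x - y)) * (x - y) ord0 i * (x - y) ord0 j
   + (2 * h1 (dot (x - y) (x - y)) - 2 * eta) * (i == j)%:R).
Proof.
rewrite partial_bump.
have D1 := is_derive_comp1 (g := fun x : 'rV[R]_d => dot (x - y) (x - y))
   (dh1 (dot_ge0 (x - y)))
   (is_derive_sqdist y x (ebasis R j)).
have D2 z : is_derive x (ebasis R j) (fun x => (x - z) ord0 i) (i == j)%:R.
  rewrite (_ : (fun _ => _) = (fun x : 'rV[R]_d => x ord0 i) - cst (z ord0 i)); last first.
    by apply/funext => w; rewrite !mxE.
  have := is_derive_coord i x (ebasis R j) => D.
  by apply: is_derive_eq; rewrite /ebasis mxE eqxx subr0.
have D3 := D2 y; have D4 := D2 x0.
rewrite (_ : (fun _ => _) = cst 2 * (h1 \o (fun x => dot (x - y) (x - y))) *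
  (fun x => (x - y) ord0 i) - cst (2 * eta) * (fun x => (x - x0) ord0 i)) //.
apply: is_derive_eq; rewrite !dot_ebasis !scaler0 !addr0 /GRing.scale /=.
by rewrite (_ : (_ * (h1 \o _)) x = 2 * h1 (dot (x - y) (x - y))) //; ring.
Qed.

Lemma partial_partial_bump y x0 eta i j :
  partial j (partial i (bump y x0 eta)) = fun x =>
  4 * h2 (dot (x - y) (x - y)) * (x - y) ord0 i * (x - y) ord0 j
   + (2 * h1 (dot (x - y) (x - y)) - 2 * eta) * (i == j)%:R.
Proof.
by apply/funext => x; case: (is_derive_partial_bump y x0 eta i j x).
Qed.

Lemma C2_near_bump y x0 eta x : C2_near (bump y x0 eta) x.
Proof.
apply: (@nearW _ (nbhs x)) => z.
pose C (f : 'rV[R]_d -> R) := {for z, continuous f}.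
have cD f g : C f -> C g -> C (fun x => f x + g x) := @continuousD _ _ _ f g z.
have cB f g : C f -> C g -> C (fun x => f x - g x) := @continuousB _ _ _ f g z.
have cM f g : C f -> C g -> C (fun x => f x * g x) := @continuousM _ _ f g z.
have cC a : C (fun=> a) by exact: cst_continuous.
have cX (w : 'rV[R]_d) i : C (fun x => (x - w) ord0 i) by exact: continuous_coordB.
have ct w : C (fun x => dot (x - w) (x - w)) by exact: continuous_sqdist.
have cc (f : R -> R) : {for dot (z - y) (z - y), continuous f} ->
    C (fun x => f (dot (x - y) (x - y))) by exact: continuous_comp (ct y).
have c0 : {for dot (z - y) (z - y), continuous h}.
  apply: differentiable_continuous; apply/derivable1_diffP.
  by case: (dh (dot_ge0 (z - y))).
have c1 : {for dot (z - y) (z - y), continuous h1}.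
  apply: differentiable_continuous; apply/derivable1_diffP.
  by case: (dh1 (dot_ge0 (z - y))).
have c2 := ch2 (dot_ge0 (z - y)).
split.
- exact: cB (cc _ c0) (cM _ _ (cC eta) (ct x0)).
- move=> i; split; first by case: (is_derive_bump y x0 eta i z).
  rewrite partial_bump.
  exact: cB (cM _ _ (cM _ _ (cC 2) (cc _ c1)) (cX y i))
    (cM _ _ (cC (2 * eta)) (cX x0 i)).
- move=> i j; split; first by case: (is_derive_partial_bump y x0 eta i j z).
  rewrite partial_partial_bump.
  apply: cD.
    by apply: (cM _ _ (cM _ _ (cM _ _ (cC 4) (cc _ c2)) (cX y i)) (cX y j)).
  exact: cM (cB _ _ (cM _ _ (cC 2) (cc _ c1)) (cC (2 * eta))) (cC (i == j)%:R).
Qed.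

(** The gradient [p] of the test function is an eigenvector of its Hessian, with eigenvalue
    [4 * t * h2 t + 2 * h1 t - 2 * eta]. Both terms of the equation then share the positive factor
    |p|^(2 - gamma), and what remains is [2 * g - 2 * eta], which equals [g] for the chosen
    [eta]. *)
Lemma touching_inequality (gamma : R) (q : 'rV[R]_d -> 'rV[R]_d)
    (u : 'rV[R]_d -> R) (y x0 : 'rV[R]_d) (t := dot (x0 - y) (x0 - y)) :
  viscosity_supersolution gamma
    (fun x _ p => dot (q x) p * enorm p `^ (2 - gamma)) setT u ->
  0 < t -> h1 t < 0 -> u x0 = h t ->
  (forall x, h (dot (x - y) (x - y)) <= u x) ->
  2 * t * h2 t <= - h1 t * (1 + dot (q x0) (x0 - y)).
Proof.
move=> husol t0 h1t ux0 hmin; rewrite leNgt; apply/negP => hlt.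
pose g := 2 * t * h2 t + h1 t * (1 + dot (q x0) (x0 - y)).
have g0 : 0 < g by rewrite /g; lra.
(* The gradient at x0 is 2 h1 (x0 - y) and the quadratic term shifts the
   Hessian by - 2 eta, so a small eta preserves the strict inequality. *)
pose eta := g / 2.
have eta0 : 0 < eta by rewrite divr_gt0.
have := husol x0 (bump y x0 eta) I (@C2_near_bump y x0 eta x0).
have -> : bump y x0 eta x0 = h t.
  rewrite /bump subrr /dot [X in eta * X]big1 ?mulr0 ?subr0 // => i _.
  by rewrite mxE mul0r.
have near : \forall x \near x0^', bump y x0 eta x < u x.
  apply: (@nearW _ (nbhs x0)) => x xx0; apply: lt_le_trans (hmin x).
  by rewrite /bump ltrBlDr ltrDl mulr_gt0 // dot_gt0 subr_eq0.
move=> /(_ ux0 near).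
pose w := x0 - y.
pose p := (2 * h1 t) *: w.
have pE : grad (bump y x0 eta) x0 = p.
  by apply/rowP => i; rewrite /grad !mxE partial_bump !mxE -/t -/w; ring.
have h10 : 2 * h1 t != 0 by rewrite mulf_neq0 // lt_eqF.
have dpp : dot p p = (2 * h1 t) ^+ 2 * t by rewrite dotZr dotC dotZr /t; ring.
have dpp0 : 0 < dot p p by rewrite dpp mulr_gt0 // exprn_even_gt0.
have p0 : p != 0 by rewrite -dot_gt0.
have np : 0 < enorm p by rewrite sqrtr_gt0.
rewrite /inf_laplacian pE (negbTE p0).
set S := \sum_(i < d) _.
have SE : S = (2 * h1 t) ^+ 2 * t * (4 * t * h2 t + 2 * h1 t - 2 * eta).
  have row i : \sum_(j < d) p ord0 i * hessian (bump y x0 eta) x0 i j * p ord0 j =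
      (2 * h1 t) ^+ 2 * (4 * t * h2 t + 2 * h1 t - 2 * eta) * (w ord0 i * w ord0 i).
    transitivity (\sum_(j < d)
      ((2 * h1 t) ^+ 2 * 4 * h2 t * w ord0 i ^+ 2 * (w ord0 j * w ord0 j)
       + (2 * h1 t) ^+ 2 * (2 * h1 t - 2 * eta) * w ord0 i * (w ord0 j * (i == j)%:R))).
      apply: eq_bigr => j _; rewrite [hessian _ _ i j]mxE partial_partial_bump -/t -/w.
      rewrite [p ord0 i]mxE [p ord0 j]mxE; ring.
    rewrite big_split /= -!mulr_sumr -/(dot w w) -[dot w w]/t.
    rewrite (bigD1 i) //= big1 ?eqxx => [|j ji]; last by rewrite eq_sym (negbTE ji) mulr0.
    rewrite mulr1n addr0; ring.
  rewrite /S (eq_bigr _ (fun i _ => row i)) -mulr_sumr -/(dot w w) -[dot w w]/t; ring.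
(* Splitting the exponent exposes the factor shared with the infinity Laplacian; it relies on [p]
   being nonzero. *)
have -> : enorm p `^ (2 - gamma) = enorm p `^ (- gamma) * dot p p.
  rewrite addrC powRD; last by rewrite (gt_eqF np) implybT.
  by rewrite powR_mulrn ?sqr_sqrtr ?dot_ge0 ?ltW.
apply/negP; rewrite -ltNge SE dpp dotZr.
rewrite [ltRHS](_ : _ =
  enorm p `^ (- gamma) * ((2 * h1 t) ^+ 2 * t * (2 * g - 2 * eta))).
  apply: mulr_gt0; first exact: powR_gt0.
  by rewrite -dpp mulr_gt0 // /eta; lra.
rewrite /g; ring.
Qed.
End RadialTestFunction.

(** A minimum of the difference becomes a contact once the minimal value is added to [h]; the
    derivatives do not change. *)
Lemma touching_min (R : realType) (d : nat) (h h1 h2 : R -> R) (gamma : R)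
    (q : 'rV[R]_d -> 'rV[R]_d) (u : 'rV[R]_d -> R)
    (y x0 : 'rV[R]_d) (t := dot (x0 - y) (x0 - y)) :
  (forall s : R, 0 <= s -> is_derive s 1 h (h1 s)) ->
  (forall s : R, 0 <= s -> is_derive s 1 h1 (h2 s)) ->
  (forall s : R, 0 <= s -> {for s, continuous h2}) ->
  viscosity_supersolution gamma
    (fun x _ p => dot (q x) p * enorm p `^ (2 - gamma)) setT u ->
  0 < t -> h1 t < 0 ->
  (forall x, u x0 - h t <= u x - h (dot (x - y) (x - y))) ->
  2 * t * h2 t <= - h1 t * (1 + dot (q x0) (x0 - y)).
Proof.
move=> dh dh1 ch2 husol t0 h1t hmin.
apply: (@touching_inequality R d (fun s => (u x0 - h t) + h s) h1 h2 _ dh1 ch2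
  gamma q u y x0 husol t0 h1t).
- move=> s s0; rewrite (_ : (fun _ => _) = cst (u x0 - h t) + h) //.
  by have ? := dh s s0; apply: is_derive_eq; rewrite add0r.
- by rewrite subrK.
- by move=> x; rewrite -lerBrDr.
Qed.

(** * Attained minima and Euclidean balls *)

(** Without a minimum, the open sets where [f] exceeds [f x], for [x] in [A], cover [A]. In a finite
    subcover, the index with the least value of [f] lies in none of the chosen sets. *)
Lemma lsc_compact_min (T : ptopologicalType) (R : realType) (f : T -> R) (A : set T) :
  A !=set0 -> compact A -> (forall a, open [set x | a < f x]) ->
  exists2 c, A c & forall x, A x -> f c <= f x.
Proof.
move=> [a0 Aa0] cA fo; apply: contrapT => nomin.
have lower c : A c -> exists2 x, A x & f x < f c.
  move=> Ac; apply: contrapT => nx; apply: nomin; exists c => // x Ax.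
  by rewrite leNgt; apply/negP => fxc; apply: nx; exists x.
move: cA; rewrite compact_cover => /(_ T A (fun x => [set z | f x < f z])).
case=> [i _ | z /lower[x Ax xz] | D DA Dcov]; [exact: fo | by exists x |].
have [i0 i0D _] := Dcov _ Aa0.
have [i _ imin] := @Order.TotalTheory.arg_minP _ _ _ (FSetSub i0D) xpredT
  (fun i => f (val i)) isT.
have [|j jD] := Dcov (val i).
  by apply: set_mem; apply: DA; exact: valP.
by rewrite /= ltNge (imin (FSetSub jD) isT).
Qed.

Section EuclideanBalls.
Variables (R : realType) (d : nat).
Implicit Types x y z : 'rV[R]_d.

Lemma coord_sqr_le_dot x i : x ord0 i ^+ 2 <= dot x x.
Proof.
rewrite expr2 /dot (bigD1 i) //= lerDl.
by apply: sumr_ge0 => j _; rewrite -expr2 sqr_ge0.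
Qed.

Lemma compact_sqdist_le y (r : R) : compact [set x | dot (x - y) (x - y) <= r].
Proof.
(* The half-width [r + 1] avoids a square root: if s^2 <= r, then (|s| - 1/2)^2 >= 0 gives |s| <= r
   + 1/4. *)
pose box := [set x : 'rV[R]_d | forall i,
  `[y ord0 i - (r + 1), y ord0 i + (r + 1)]%classic (x ord0 i)].
apply: (@subclosed_compact _ _ box).
- apply: (@preimage_closed _ R (fun x : 'rV[R]_d => dot (x - y) (x - y))
    [set t : R | t <= r]); last exact: closed_le.
  move=> x _; exact: (@continuous_sqdist R d y x).
- apply: (@rV_compact _ _ (fun i =>
    `[y ord0 i - (r + 1), y ord0 i + (r + 1)]%classic)).
  by move=> i; exact: segment_compact.
- move=> x /= xr i; have := coord_sqr_le_dot (x - y) i; rewrite /= in_itv /= !mxE => h.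
  have := sqr_ge0 (x ord0 i - y ord0 i - 2^-1).
  have := sqr_ge0 (x ord0 i - y ord0 i + 2^-1).
  by move=> *; apply/andP; split; lra.
Qed.

(** Library balls are those of the sup norm, which the Euclidean norm dominates, so the squared
    radius of such a ball serves as [r]. *)
Lemma nbhs_sqdist y (P : set 'rV[R]_d) : nbhs y P ->
  exists2 r : R, 0 < r & forall x, dot (x - y) (x - y) < r -> P x.
Proof.
move=> /nbhs_ballP[e /= e0 eP]; exists (e ^+ 2); first by rewrite exprn_gt0.
move=> x xr; apply: eP; split => // i j; rewrite (ord1 i) /ball /= distrC.
have := le_lt_trans (coord_sqr_le_dot (x - y) j) xr; rewrite !mxE.
by move=> lt_e; rewrite -(@ltr_pXn2r _ 2) ?nnegrE ?(ltW e0) // real_normK ?num_real.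
Qed.

Lemma open_gt_subl (u g : 'rV[R]_d -> R) :
  (forall a, open [set x | a < u x]) -> continuous g ->
  forall a, open [set x | a < u x - g x].
Proof.
move=> uo gc a; rewrite openE => x /= axx; rewrite /interior.
pose e := (u x - g x - a) / 2.
have e0 : 0 < e by rewrite divr_gt0 // subr_gt0.
have nu : nbhs x [set z | u x - e < u z].
  by apply: open_nbhs_nbhs; split; [exact: uo | rewrite /= ltrBlDr ltrDl].
have nge : nbhs (g x) [set t | t < g x + e].
  by apply: open_nbhs_nbhs; split; [exact: open_lt | rewrite /= ltrDl].
have ng : nbhs x [set z | g z < g x + e] := gc x _ nge.
apply: filterS (filterI nu ng) => z [] /=; rewrite /e; lra.
Qed.

(** The minimum over the compact ball is global, because [z] lies in the ball and does at least as
    well as every point outside. *)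
Lemma exists_global_min (u g : 'rV[R]_d -> R) y z (r : R) :
  (forall a, open [set x | a < u x]) -> continuous g ->
  dot (z - y) (z - y) <= r ->
  (forall x, r < dot (x - y) (x - y) -> u z - g z <= u x - g x) ->
  exists x0, forall x, u x0 - g x0 <= u x - g x.
Proof.
move=> uo gc zr out.
have [c cr cmin] : exists2 c, [set x | dot (x - y) (x - y) <= r] c &
    forall x, [set x | dot (x - y) (x - y) <= r] x -> u c - g c <= u x - g x.
  apply: lsc_compact_min; [by exists z | exact: compact_sqdist_le |].
  exact: open_gt_subl.
exists c => x; have [/cmin //|/out] := leP (dot (x - y) (x - y)) r.
exact: le_trans (cmin z zr).
Qed.
End EuclideanBalls.

(** * Derivatives of the logarithmic and exponential barriers *)

Section Barriers.
Variables (R : realType) (d : nat).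

Lemma is_derive1_continuous (f : R -> R) (s a : R) :
  is_derive s 1 f a -> {for s, continuous f}.
Proof.
by case=> D _; apply: differentiable_continuous; apply/derivable1_diffP.
Qed.

Lemma is_derive_log_barrier (e s : R) : 0 <= s ->
  is_derive s 1 (fun s => - e * ln (1 + s)) (- e * (1 + s)^-1).
Proof.
move=> s0; have s1 : 0 < 1 + s by lra.
have dlin : is_derive s 1 (fun s : R => 1 + s) 1.
  by rewrite (_ : (fun _ => _) = cst 1 + id) //; apply: is_derive_eq; rewrite add0r.
have ? := is_derive1_comp (is_derive1_ln s1) dlin.
rewrite (_ : (fun _ => _) = cst (- e) * (@ln R \o (fun s => 1 + s))) //.
by apply: is_derive_eq; rewrite /GRing.scale /= mulr0 addr0 mulr1.
Qed.

Lemma is_derive_log_barrier1 (e s : R) : 0 <= s ->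
  is_derive s 1 (fun s => - e * (1 + s)^-1) (e * ((1 + s)^-1 * (1 + s)^-1)).
Proof.
move=> s0; have s1 : 0 < 1 + s by lra.
have dlin : is_derive s 1 (fun s : R => 1 + s) 1.
  by rewrite (_ : (fun _ => _) = cst 1 + id) //; apply: is_derive_eq; rewrite add0r.
have ? := is_deriveV (lt0r_neq0 s1) dlin.
rewrite (_ : (fun _ => _) = cst (- e) * (fun s => (1 + s)^-1)) //.
apply: is_derive_eq; rewrite /GRing.scale /= mulr0 addr0 mulr1 mulrNN.
by rewrite expr2 invfM.
Qed.

Lemma is_derive_exp_barrier (c a s : R) :
  is_derive s 1 (fun s => c * expR (- a * s)) (c * - a * expR (- a * s)).
Proof.
have dlin : is_derive s 1 (fun s : R => - a * s) (- a).
  rewrite (_ : (fun _ => _) = cst (- a) * id) //; apply: is_derive_eq.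
  by rewrite scaler0 addr0 [_ *: _]mulr1.
have ? := is_derive1_comp (is_derive_expR _) dlin.
rewrite (_ : (fun _ => _) = cst c * (@expR R \o (fun s => - a * s))) //.
apply: is_derive_eq; rewrite /GRing.scale /= mulr0 addr0; ring.
Qed.

Lemma continuous_sqdist_comp (h : R -> R) (y : 'rV[R]_d) :
  (forall t : R, 0 <= t -> {for t, continuous h}) ->
  continuous (fun x : 'rV[R]_d => h (dot (x - y) (x - y))).
Proof.
move=> hc x; apply: (@continuous_comp 'rV[R]_d R R (fun x => dot (x - y) (x - y)) h).
  exact: continuous_sqdist.
by apply: hc; exact: dot_ge0.
Qed.

End Barriers.

(** * The Liouville property *)

Section Liouville.
Variables (R : realType) (d : nat) (gamma : R).
Variables (q : 'rV[R]_d -> 'rV[R]_d) (u : 'rV[R]_d -> R).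
Hypothesis uo : forall a, open [set x | a < u x].
Hypothesis husol : viscosity_supersolution gamma
  (fun x _ p => dot (q x) p * enorm p `^ (2 - gamma)) setT u.

(** The factor [e * (1 + t)^-1] cancels from the touching inequality. The conclusion is free of [e],
    so it confines the minimum points to one ball for all [e] at once. *)
Lemma log_barrier (e : R) (y x0 : 'rV[R]_d) (t := dot (x0 - y) (x0 - y)) :
  0 < e -> 0 < t ->
  (forall x, u x0 - - e * ln (1 + t) <= u x - - e * ln (1 + dot (x - y) (x - y))) ->
  2 * t <= (1 + t) * (1 + dot (q x0) (x0 - y)).
Proof.
move=> e0 t0 x0min.
have t1 : 0 < 1 + t by lra.
have := @touching_min R d (fun s => - e * ln (1 + s))
  (fun s => - e * (1 + s)^-1) (fun s => e * ((1 + s)^-1 * (1 + s)^-1)) gamma q u y x0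
  (@is_derive_log_barrier R e) (@is_derive_log_barrier1 R e).
rewrite -/t => T.
have : 2 * t * (e * ((1 + t)^-1 * (1 + t)^-1)) <=
    - (- e * (1 + t)^-1) * (1 + dot (q x0) (x0 - y)).
  apply: T => //.
  - move=> s s0.
    (* The coefficient -1 yields continuity of [(1 + s)^-1] itself, up to a double sign. *)
    have c1 := is_derive1_continuous (is_derive_log_barrier1 (-1) s0).
    have := continuousM (continuousM (cst_continuous (x := e)(x0:=s)) c1) c1.
    congr continuous_at; apply/funext => z /=; rewrite opprK mul1r -mulrA //.
  - by rewrite mulNr oppr_lt0 mulr_gt0 // invr_gt0.
rewrite [leLHS](_ : _ = e * (1 + t)^-1 * (2 * t / (1 + t))); last by ring.
rewrite [leRHS](_ : _ = e * (1 + t)^-1 * (1 + dot (q x0) (x0 - y))); last by ring.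
rewrite ler_pM2l; last by rewrite mulr_gt0 // invr_gt0.
by rewrite ler_pdivrMr // [leRHS]mulrC.
Qed.

(** Dividing the touching inequality by [c * a * expR (- a * t)] leaves [a] on the left only, so a
    large [a] excludes contact wherever [t] is bounded below and the drift term above. *)
Lemma exp_barrier (c a : R) (y x0 : 'rV[R]_d) (t := dot (x0 - y) (x0 - y)) :
  0 < c -> 0 < a -> 0 < t ->
  (forall x, u x0 - c * expR (- a * t) <= u x - c * expR (- a * dot (x - y) (x - y))) ->
  2 * t * a <= 1 + dot (q x0) (x0 - y).
Proof.
move=> c0 a0 t0 x0min.
have T := @touching_min R d (fun s => c * expR (- a * s))
  (fun s => c * - a * expR (- a * s)) (fun s => c * - a * - a * expR (- a * s))
  gamma q u y x0 (fun s _ => is_derive_exp_barrier c a s)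
  (fun s _ => is_derive_exp_barrier (c * - a) a s)
  (fun s _ => is_derive1_continuous (is_derive_exp_barrier (c * - a * - a) a s))
  husol t0.
have ce : 0 < c * a * expR (- a * t) by rewrite !mulr_gt0 ?expR_gt0.
have h1 : c * - a * expR (- a * t) < 0 by rewrite mulrN mulNr oppr_lt0.
rewrite -(ler_pM2l ce); have := T h1 x0min; rewrite -/t.
by congr (is_true (_ <= _)); ring.
Qed.

Lemma supersolution_min_attained (L theta r0 : R) :
  (forall x, L <= u x) -> theta < 1 ->
  (forall x, r0 < enorm x -> dot (q x) x <= theta) ->
  exists z, forall x, u z <= u x.
Proof.
move=> uL th1 qth.
(* Beyond [r0 ^+ 2] the bound on the drift is available; beyond the second value, 2 t > (1 + t) (1 +
   theta), against [log_barrier]. *)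
pose T0 := Num.max (r0 ^+ 2) ((1 + theta) / (1 - theta)).
have T00 : 0 <= T0 by rewrite le_max sqr_ge0.
pose K := [set x : 'rV[R]_d | dot (x - 0) (x - 0) <= T0].
have K0 : K !=set0 by exists 0; rewrite /K /= subrr (eqP (_ : dot 0 0 == 0)) // dot_eq0.
have [z zT zmin] := lsc_compact_min K0 (@compact_sqdist_le R d 0 T0) uo.
exists z => x.
have cmp e : 0 < e -> u z <= u x - - e * ln (1 + dot (x - 0) (x - 0)).
  move=> e0.
  have gc : continuous (fun x : 'rV[R]_d => - e * ln (1 + dot (x - 0) (x - 0))).
    apply: (@continuous_sqdist_comp R d (fun s => - e * ln (1 + s)) 0) => t t0.
    exact: is_derive1_continuous (is_derive_log_barrier e t0).
  have g0 w : 0 <= ln (1 + dot (w - 0) (w - 0)) by rewrite ln_ge0 // lerDl dot_ge0.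
  pose g0z := u z - - e * ln (1 + dot (z - 0) (z - 0)).
  (* The radius keeps [z] inside, and outside it e ln (1 + |w|^2) is at least [g0z - L], so the
     lower bound [L] on [u] lifts the difference above its value [g0z] at [z]. *)
  have [|w|c cmin] := @exists_global_min R d u _ 0 z
    (Num.max (dot (z - 0) (z - 0)) (expR ((g0z - L) / e))) uo gc.
  - by rewrite le_max lexx.
  - rewrite gt_max => /andP[_ wbig]; apply: le_trans (_ : L + (g0z - L) <= _).
      by rewrite -/g0z [leRHS]addrC subrK.
    rewrite mulNr opprK lerD // mulrC -ler_pdivrMr // -[leLHS]expRK.
    rewrite ler_ln ?posrE ?expR_gt0 //.
      by lra.
    by have := dot_ge0 (w - 0); lra.
  apply: le_trans (cmin x).
  (* In [K], the minimality of [z] applies to [c], and the barrier is nonpositive there. Outside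
     [K], [log_barrier] gives a contradiction. *)
  have [cT|Tc] := leP (dot (c - 0) (c - 0)) T0.
    by apply: le_trans (zmin _ cT) _; rewrite mulNr opprK lerDl mulr_ge0 ?(ltW e0) ?g0.
  exfalso.
  have := log_barrier e0 (le_lt_trans T00 Tc) cmin.
  have rc : r0 < enorm c.
    have [r00|r00] := ltP r0 0; first exact: lt_le_trans r00 (sqrtr_ge0 _).
    rewrite -(@ltr_pXn2r _ 2) ?nnegrE ?sqrtr_ge0 // sqr_sqrtr ?dot_ge0 //.
    by move: Tc; rewrite gt_max subr0 => /andP[].
  have := qth _ rc; move: Tc; rewrite subr0 gt_max => /andP[_].
  rewrite ltr_pdivrMr ?subr_gt0 // => h1 h2 h3.
  suff : (1 + dot c c) * (1 + dot (q c) c) <= (1 + dot c c) * (1 + theta) by lra.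
  by rewrite ler_wpM2l // ?lerD2l // addr_ge0 // dot_ge0.
rewrite leNgt; apply/negP => xz.
set l := ln _ in cmp.
have l0 : 0 <= l by rewrite ln_ge0 // lerDl dot_ge0.
have l1 : 0 < l + 1 by lra.
(* A definite [e] replaces the limit: e l < u z - u x contradicts [cmp], and adding 1 keeps the
   denominator positive when [l] is 0. *)
have := cmp ((u z - u x) / (l + 1)).
rewrite divr_gt0 ?subr_gt0 // => /(_ isT).
rewrite mulNr opprK leNgt => /negP; apply.
by rewrite -ltrBrDl mulrAC ltr_pdivrMr // ltr_pM2l ?subr_gt0 // ltrDl.
Qed.

Lemma supersolution_strong_min (z : 'rV[R]_d) : continuous q ->
  (forall x, u z <= u x) -> forall y, u y = u z.
Proof.
move=> qc zmin y; apply/eqP; rewrite eq_le zmin andbT leNgt; apply/negP => zy.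
pose c := (u y - u z) / 2.
have c0 : 0 < c by rewrite divr_gt0 // subr_gt0.
have [r r0 ry] : exists2 r : R, 0 < r &
    forall x, dot (x - y) (x - y) < r -> u z + c < u x.
  apply: nbhs_sqdist; apply: open_nbhs_nbhs; split; first exact: uo.
  by rewrite /= /c; lra.
pose b := dot (z - y) (z - y).
have bz : r <= b by rewrite leNgt; apply/negP => /ry; lra.
(* The maximum over the compact ball is obtained as a minimum of the opposite, written as 0 minus a
   continuous function to fit [open_gt_subl]. *)
have [M qM] : exists M, forall x, dot (x - y) (x - y) <= b -> dot (q x) (x - y) <= M.
  have cq : continuous (fun x => dot (q x) (x - y)).
    move=> x; apply: (@continuous_dot R d _ q (fun x => x - y)); first exact: qc.
    exact: continuous_subr.
  have [||w _ wmin] := @lsc_compact_min _ R (fun x => 0 - dot (q x) (x - y))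
    [set x | dot (x - y) (x - y) <= b] _ (@compact_sqdist_le R d y b).
  - by exists z => /=.
  - apply: open_gt_subl cq => a; have [a0|a0] := ltP a 0.
      by rewrite (_ : [set _ | _] = setT); [exact: openT | apply/seteqP; split].
    by rewrite (_ : [set _ | _] = set0); [exact: open0 | apply/seteqP; split].
  by exists (dot (q w) (w - y)) => x /wmin; lra.
(* This makes [2 * r * a] exceed [1 + M], which [exp_barrier] forbids at a contact with r <= t <=
   b. *)
pose a := (`|1 + M| + 1) / (2 * r).
have a0 : 0 < a by rewrite divr_gt0 ?mulr_gt0 // ltr_pwDr.
have gc : continuous (fun x : 'rV[R]_d => c * expR (- a * dot (x - y) (x - y))).
  apply: (@continuous_sqdist_comp R d (fun s => c * expR (- a * s)) y) => t _.
  exact: is_derive1_continuous (is_derive_exp_barrier c a t).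
have glt s : b < s -> c * expR (- a * s) < c * expR (- a * b).
  by move=> bs; rewrite ltr_pM2l // ltr_expR !mulNr ltrN2 ltr_pM2l.
have [x bx|x0 x0min] := @exists_global_min R d u _ y z b uo gc (lexx b).
  by apply: lerB => //; exact/ltW/glt.
have := x0min z; rewrite -/b => x0z.
set t := dot (x0 - y) (x0 - y) in x0z.
(* Closer to [y], [u] exceeds [u z + c] while the barrier is at most [c], so the difference would
   exceed [u z], hence its value at [z]. *)
have tr : r <= t.
  rewrite leNgt; apply/negP => /ry h.
  have g1 : c * expR (- a * t) <= c.
    rewrite ger_pMr // -expR0 ler_expR mulNr oppr_le0 mulr_ge0 ?dot_ge0 //; exact: ltW.
  have : 0 < c * expR (- a * b) by rewrite mulr_gt0 // expR_gt0.
  lra.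
have tb : t <= b.
  rewrite leNgt; apply/negP => /glt h; have := zmin x0; lra.
have := exp_barrier c0 a0 (lt_le_trans r0 tr) x0min.
rewrite -/t => h; have := qM _ tb => h2.
have : 2 * r * a <= 2 * t * a by rewrite ler_pM2r // ler_pM2l.
have -> : 2 * r * a = `|1 + M| + 1 by rewrite /a mulrC divfK // mulf_neq0 // gt_eqF.
have := ler_norm (1 + M); lra.
Qed.

End Liouville.

Theorem theorem2p5 (R : realType) (d : nat) (gamma : R)
    (hgamma : 0 <= gamma <= 2)
    (q : 'rV[R]_d -> 'rV[R]_d) (hq : continuous q)
    (hlimsup : (limf_esup (fun x => (Num.max (dot (q x) x) 0)%:E)
                  (at_infinity R d) < 1%:E)%E)
    (u : 'rV[R]_d -> R)
    (hlsc : lower_semicontinuous (fun x => (u x)%:E))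
    (hinf : (-oo < ereal_inf (range (fun x => (u x)%:E)))%E)
    (husol : viscosity_supersolution gamma
               (fun x _ p => dot (q x) p * enorm p `^ (2 - gamma)) setT u) :
  exists c : R, forall x : 'rV[R]_d, u x = c.
Proof.
have uo a : open [set x | a < u x].
  have /lower_semicontinuousP/(_ a) := hlsc.
  by under eq_set do rewrite lte_fin.
have [L uL] : exists L, forall x, L <= u x.
  move: hinf; case E : (ereal_inf _) => [L||] // _.
    exists L => x; rewrite -lee_fin -E; apply: ereal_inf_lbound; by exists x.
  (* The infimum cannot be +oo, since the real number [u 0] belongs to the range. *)
  have := @ereal_inf_lbound R (range (fun x => (u x)%:E)) (u 0)%:E.
  by rewrite E => /(_ (ex_intro2 _ _ 0 I erefl)); rewrite leye_eq.
(* The upper limit is an infimum of suprema over the sets of the filter, so one such supremum is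
   already below 1, on a set [A] containing the exterior of a ball. *)
have [_ [A [r _ rA] <-]] := ereal_inf_lt hlimsup.
move=> supA.
have qsup x : A x -> ((Num.max (dot (q x) x) 0)%:E <=
    ereal_sup [set (Num.max (dot (q x) x) 0)%:E | x in A])%E.
  by move=> Ax; apply: ereal_sup_ubound; exists x.
have [theta th1 qth] : exists2 theta, theta < 1 &
    forall x, r < enorm x -> dot (q x) x <= theta.
  move: supA qsup; case: (ereal_sup _) => [th||] //.
    rewrite lte_fin => th1 h; exists th => // x /rA /h.
    by rewrite lee_fin ge_max => /andP[].
  (* A supremum equal to -oo means that [A] is empty, and the bound holds vacuously. *)
  move=> _ h; exists 0; rewrite ?ltr01 // => x /rA /h.
  by rewrite leeNy_eq.
have [z zmin] := supersolution_min_attained uo husol uL th1 qth.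
have const_u := supersolution_strong_min uo husol.
by exists (u z); exact: const_u.
Qed.
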